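(* Let $\alpha=\frac{2\pi}{3}$ and let $\alpha,\beta,\gamma,\delta$ be distinct. The spherical tiling by $12$ angle congruent pentagons with angles $\alpha,\alpha,\beta,\gamma,\delta$ is, up to symmetry, given by the following (angle words on the dodecahedral pattern, as explained in the context): $P_1:\delta\alpha\beta\gamma\alpha$; $P_2:\alpha\delta\alpha\beta\gamma$; $P_3:\beta\gamma\alpha\delta\alpha$; $P_4:\alpha\beta\gamma\alpha\delta$; $P_5:\gamma\alpha\delta\alpha\beta$; $P_6:\delta\alpha\beta\gamma\alpha$; $P_7:\gamma\alpha\delta\alpha\beta$; $P_8:\alpha\beta\gamma\alpha\delta$; $P_9:\beta\gamma\alpha\delta\alpha$; $P_{10}:\alpha\delta\alpha\beta\gamma$; $P_{11}:\delta\alpha\beta\gamma\alpha$; $P_{12}:\gamma\alpha\delta\alpha\beta$; where, around any of the six edges $E_{1,5},E_{2,3},E_{4,8},E_{6,11},E_{7,12},E_{9,10}$ (independently), one can exchange the four angles $\beta$ and $\gamma$ around that edge and still get a tiling; the tilings so obtained are included.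
   Context: A spherical tiling by $12$ pentagons (graph embedded in $S^2$ with all vertices of degree $\ge 3$, every tile a five-edged region enclosed by a simple closed curve; edges may be any nice curves) is combinatorially the dodecahedral pattern: tiles $P_1,\dots,P_{12}$, where $P_i$ with list $(n_1,\dots,n_5)$ has edges in counterclockwise order $E_{i,n_1},\dots,E_{i,n_5}$, $E_{i,j}=E_{j,i}$ being the common edge of $P_i$ and $P_j$, and (with $n_6=n_1$) $E_{i,n_k},E_{i,n_{k+1}}$ meet at the vertex $V_{i,n_k,n_{k+1}}$ of degree $3$ shared by $P_i,P_{n_k},P_{n_{k+1}}$: $P_1:(2,3,4,5,6)$; $P_2:(1,6,11,7,3)$; $P_3:(1,2,7,8,4)$; $P_4:(1,3,8,9,5)$; $P_5:(1,4,9,10,6)$; $P_6:(1,5,10,11,2)$; $P_7:(12,8,3,2,11)$; $P_8:(12,9,4,3,7)$; $P_9:(12,10,5,4,8)$; $P_{10}:(12,11,6,5,9)$; $P_{11}:(12,7,2,6,10)$; $P_{12}:(7,11,10,9,8)$. ''$P_i:w_1w_2w_3w_4w_5$'' means that the angle of $P_i$ at $V_{i,n_k,n_{k+1}}$ is $w_k$ for $k=1,\dots,5$. An angle congruent tiling is considered as an assignment of angles to all (tile, vertex) corners such that the angles at every vertex sum to $2\pi$ and any two tiles are angle congruent, i.e. there is an adjacency-preserving correspondence of their edges that preserves the angles between adjacent edges (reflections allowed). No geometric realization by great arcs is required. The four angles around an edge $E_{i,j}$ are the angles of $P_i$ and of $P_j$ at the two end vertices of $E_{i,j}$; exchanging $\beta$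 and $\gamma$ around it means replacing $\beta$ by $\gamma$ and $\gamma$ by $\beta$ in these four corners. ''Up to symmetry'' means up to symmetries of the dodecahedral pattern (including reflections) and up to permuting the names $\beta,\gamma,\delta$. *)

(* Defs.v *)
From mathcomp Require Import all_boot all_order all_algebra all_fingroup.
From mathcomp Require Import all_classical all_reals all_analysis.

Set Implicit Arguments.
Unset Strict Implicit.
Unset Printing Implicit Defensive.

Import Order.TTheory GRing.Theory Num.Theory.
Local Open Scope ring_scope.

(* The tables below use the labels 1, ..., 12; the tile P_n is the ordinal
   of value n - 1. *)
Definition tile := 'I_12.

Definition P (n : nat) : tile := inZp n.-1.

Definition neighbor_table : seq (seq nat) :=
  [:: [:: 2; 3; 4; 5; 6];
      [:: 1; 6; 11; 7; 3];
      [:: 1; 2; 7; 8; 4];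
      [:: 1; 3; 8; 9; 5];
      [:: 1; 4; 9; 10; 6];
      [:: 1; 5; 10; 11; 2];
      [:: 12; 8; 3; 2; 11];
      [:: 12; 9; 4; 3; 7];
      [:: 12; 10; 5; 4; 8];
      [:: 12; 11; 6; 5; 9];
      [:: 12; 7; 2; 6; 10];
      [:: 7; 11; 10; 9; 8]]%N.

(* The tile across the k-th edge of tile i; edges are counterclockwise. *)
Definition nbr (i : tile) (k : 'I_5) : tile :=
  P (nth 0%N (nth [::] neighbor_table i) k).

Definition adjacent (i j : tile) : bool := [exists k, nbr i k == j].

(* (i, k) is the corner of tile i between its cyclically consecutive edges
   k and k + 1. *)
Definition corner := (tile * 'I_5)%type.

(* The vertex at a corner, as the list of the three tiles meeting there; two
   corners are at the same vertex when these lists agree up to order. *)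
Definition vertex (c : corner) : seq tile :=
  [:: c.1; nbr c.1 c.2; nbr c.1 (ordS c.2)].

Definition share_vertex (i j k : tile) : bool :=
  [exists c, perm_eq (vertex c) [:: i; j; k]].

Section AngleAssignment.
Variable R : realType.
Implicit Type ang : corner -> R.

(* tau is the correspondence from the edges of i to the edges of j. *)
Definition angle_congruent ang (i j : tile) : Prop :=
  exists tau : 'S_5, forall k : 'I_5, exists l : 'I_5,
    perm_eq [:: tau k; tau (ordS k)] [:: l; ordS l] /\ ang (i, k) = ang (j, l).

Definition angle_congruent_tiling ang : Prop :=
  (forall c : corner,
     \sum_(c' : corner | perm_eq (vertex c') (vertex c)) ang c' = 2 * pi) /\
  (forall i j : tile, angle_congruent ang i j).

Definition tile_angles ang (i : tile) : seq R := [seq ang (i, k) | k : 'I_5].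

End AngleAssignment.

Inductive letter := Al | Be | Ga | De.

Definition letter_val (R : Type) (alpha beta gamma delta : R) (w : letter) : R :=
  match w with Al => alpha | Be => beta | Ga => gamma | De => delta end.

Definition word_table : seq (seq letter) :=
  [:: [:: De; Al; Be; Ga; Al];
      [:: Al; De; Al; Be; Ga];
      [:: Be; Ga; Al; De; Al];
      [:: Al; Be; Ga; Al; De];
      [:: Ga; Al; De; Al; Be];
      [:: De; Al; Be; Ga; Al];
      [:: Ga; Al; De; Al; Be];
      [:: Al; Be; Ga; Al; De];
      [:: Be; Ga; Al; De; Al];
      [:: Al; De; Al; Be; Ga];
      [:: De; Al; Be; Ga; Al];
      [:: Ga; Al; De; Al; Be]].

Definition base_words (c : corner) : letter :=
  nth Al (nth [::] word_table c.1) c.2.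

(* An edge E_{i,j} is given by the pair (i, j) of its two tiles. *)
Definition edge := (tile * tile)%type.

Definition around (e : edge) (c : corner) : bool :=
  [|| (c.1 == e.1) && (e.2 \in [:: nbr c.1 c.2; nbr c.1 (ordS c.2)])
    | (c.1 == e.2) && (e.1 \in [:: nbr c.1 c.2; nbr c.1 (ordS c.2)])].

Definition swap_beta_gamma (w : letter) : letter :=
  match w with Be => Ga | Ga => Be | _ => w end.

Definition exchange (e : edge) (w : corner -> letter) : corner -> letter :=
  fun c => if around e c then swap_beta_gamma (w c) else w c.

Definition exchange_edges : seq edge :=
  [:: (P 1, P 5); (P 2, P 3); (P 4, P 8); (P 6, P 11); (P 7, P 12);
      (P 9, P 10)].

Definition exchanged_words (s : seq edge) : corner -> letter :=
  foldr exchange base_words s.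

(* Combinatorial automorphisms of the pattern: orientation may be reversed. *)
Definition pattern_symmetry (sigma : {perm tile}) : Prop :=
  (forall i j, adjacent (sigma i) (sigma j) = adjacent i j) /\
  (forall i j k, share_vertex (sigma i) (sigma j) (sigma k) = share_vertex i j k).

(* sigma moves the corner c to the corner c'. *)
Definition maps_corner (sigma : {perm tile}) (c c' : corner) : bool :=
  (c'.1 == sigma c.1) && perm_eq (vertex c') (map sigma (vertex c)).

(* Main.v *)
(** Since [alpha] is a third of [2 * pi] and the four angles are distinct, the
    count of all angles gives [beta + gamma + delta = 2 * pi], and then a vertex
    can only be [alpha alpha alpha] or [beta gamma delta]. Equivalently, two
    corners at one vertex are both [alpha], or carry distinct letters other than
    [alpha]. This makes the tilings the solutions of a binary constraint problem
    on twelve words, all in one of six dihedral classes, which an exhaustive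
    search solves: there are 960 solutions, and each of them is one of the
    exchanged base tilings with renamed letters, turned about the axis through
    [P_1] and [P_12]. The five turns move the eight [alpha] vertices through the
    five cubes inscribed in the dodecahedron.

    Conversely, in every exchanged tiling each tile is a dihedral image of the
    word [De Al Be Ga Al], and pattern symmetries act dihedrally on tiles. *)
Require Import Defs.
From HB Require Import structures.
From mathcomp Require Import all_boot all_order all_algebra all_fingroup.
From mathcomp Require Import all_classical all_reals all_analysis.
From mathcomp Require Import ring lra.

Set Implicit Arguments.
Unset Strict Implicit.
Unset Printing Implicit Defensive.

Import Order.TTheory GRing.Theory Num.Theory.
Local Open Scope ring_scope.

(** * Letters and the three corners at a vertex *)

Definition letter_code (w : letter) : nat :=
  match w with Al => 0 | Be => 1 | Ga => 2 | De => 3 end.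

Definition letter_decode (n : nat) : letter :=
  match n with 0 => Al | 1 => Be | 2 => Ga | _ => De end.

Lemma letter_codeK : cancel letter_code letter_decode.
Proof. by case. Qed.

HB.instance Definition _ := Equality.copy letter (can_type letter_codeK).

Lemma ord_all n (p : pred nat) : all p (iota 0 n) -> forall i : 'I_n, p i.
Proof. by move=> /allP p_all i; apply: p_all; rewrite mem_iota add0n ltn_ord. Qed.

Definition corner_of (i k : nat) : corner := (inZp i, inZp k).

Definition corners : seq corner :=
  [seq corner_of i k | i <- iota 0 12, k <- iota 0 5].

Lemma corner_ofK (c : corner) : corner_of c.1 c.2 = c.
Proof. by case: c => i k; rewrite /corner_of !valZpK. Qed.

Lemma mem_corners c : c \in corners.
Proof.
by rewrite -(corner_ofK c) allpairs_f // mem_iota add0n ltn_ord.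
Qed.

Lemma corner_all (p : pred corner) : all p corners -> forall c, p c.
Proof. by move=> /allP p_all c; apply/p_all/mem_corners. Qed.

Lemma corner_all2 (p : corner -> corner -> bool) :
  all (fun c => all (p c) corners) corners -> forall c d, p c d.
Proof. by move=> p_all c d; have /corner_all := corner_all p_all c; apply. Qed.

(** In the tile [j] across edge [k] of [i], the edge toward the tile across edge [k + 1] of [i] is
    followed by the edge toward [i]; the position of the former is the index of the corner of [j] at
    this vertex. The [.+1] turns an ordinal into its label in the table. *)
Definition next_corner (c : corner) : corner :=
  let j := nbr c.1 c.2 in
  (j, inZp (index (nbr c.1 (ordS c.2)).+1 (nth [::] neighbor_table j))).

Definition vertex_corners (c : corner) : seq corner :=
  [:: c; next_corner c; next_corner (next_corner c)].

Lemma same_vertexE c' c : perm_eq (vertex c') (vertex c) = (c' \in vertex_corners c).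
Proof. by apply/eqP; move: c' c; apply: corner_all2; vm_compute. Qed.

Lemma uniq_vertex_corners c : uniq (vertex_corners c).
Proof. by move: c; apply: corner_all; vm_compute. Qed.

Lemma vertexE c : vertex c = map fst (vertex_corners c).
Proof. by apply/eqP; move: c; apply: corner_all; vm_compute. Qed.

Lemma next_corner3 c : next_corner (next_corner (next_corner c)) = c.
Proof. by apply/eqP; move: c; apply: corner_all; vm_compute. Qed.

Lemma corner_eq c d : c.1 = d.1 -> perm_eq (vertex c) (vertex d) -> c = d.
Proof.
move=> e1 ev; apply/eqP; move: ev; apply/implyP; move/eqP: e1; apply/implyP.
by move: c d; apply: corner_all2; vm_compute.
Qed.

Lemma nbr_inj i : injective (nbr i).
Proof.
move=> k l e; suff: (i, k) == (i, l) by case/eqP.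
move/eqP: e; apply/implyP.
have: forall c d : corner, (c.1 == d.1) ==> (nbr c.1 c.2 == nbr d.1 d.2) ==> (c == d).
  by apply: corner_all2; vm_compute.
by move=> /(_ (i, k) (i, l)); rewrite eqxx.
Qed.

Lemma sum_same_vertex (V : nmodType) (F : corner -> V) c :
  \sum_(c' | perm_eq (vertex c') (vertex c)) F c' =
  F c + F (next_corner c) + F (next_corner (next_corner c)).
Proof.
rewrite (eq_bigl _ _ (same_vertexE^~ c)) -big_uniq ?uniq_vertex_corners //=.
by rewrite !big_cons big_nil addr0 addrA.
Qed.

(** * Dihedral maps of the pentagon and angle congruence *)

Definition ords5 : seq 'I_5 := [seq inZp k | k <- iota 0 5].

Lemma enum_ords5 : enum 'I_5 = ords5.
Proof. by apply: (inj_map val_inj); rewrite val_enum_ord. Qed.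

Lemma ords5_all (p : pred 'I_5) : all p ords5 -> forall k, p k.
Proof. by rewrite -enum_ords5 => /allP p_all k; rewrite p_all ?mem_enum. Qed.

(** Arithmetic is that of the integers modulo 5, where [b * b = 1] only for [b = 1] and [b = -1]:
    these maps are the rotations and reflections of a pentagon. *)
Definition dihedral (p : 'I_5 -> 'I_5) : Prop :=
  exists a b : 'I_5, b * b = 1 /\ forall k, p k = a + b * k.

Lemma dihedral_comp p q : dihedral p -> dihedral q -> dihedral (p \o q).
Proof.
move=> [a [b [bb pE]]] [c [d [dd qE]]]; exists (a + b * c), (b * d).
by split=> [|k]; [rewrite mulrACA bb dd mulr1 | rewrite /= pE qE mulrDr mulrA addrA].
Qed.

Lemma dihedral_inv p :
  dihedral p -> exists q, [/\ dihedral q, cancel p q & cancel q p].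
Proof.
move=> [a [b [bb pE]]]; exists (fun k => - (b * a) + b * k); split.
- by exists (- (b * a)), b.
- by move=> k; rewrite pE mulrDr addKr mulrA bb mul1r.
- by move=> k; rewrite pE mulrDr mulrN !mulrA bb !mul1r addrA addrN add0r.
Qed.

Definition consecutive (e f : 'I_5) : bool := (f == ordS e) || (e == ordS f).

(** Edges [l] and [ordS l] bound corner [l], so this is the index of the corner between two
    consecutive edges given in either order. *)
Definition joint_edge (e f : 'I_5) : 'I_5 := if f == ordS e then e else f.

Lemma joint_edgeE e f l :
  perm_eq [:: e; f] [:: l; ordS l] ->
  consecutive e f /\ l = joint_edge e f.
Proof.
have: all (fun e => all (fun f => all (fun l =>
    perm_eq [:: e; f] [:: l; ordS l] ==>
    consecutive e f && (l == joint_edge e f)) ords5) ords5) ords5.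
  by vm_compute.
by move=> /ords5_all/(_ e)/ords5_all/(_ f)/ords5_all/(_ l)/implyP H /H /andP[? /eqP].
Qed.

(** An edge permutation that keeps neighbours neighbours is a symmetry of the 5-cycle, and so is the
    map it induces on corners. The 120 permutations are inspected as lists. *)
Lemma edges_dihedral (tau : 'S_5) p :
  (forall k, perm_eq [:: tau k; tau (ordS k)] [:: p k; ordS (p k)]) -> dihedral p.
Proof.
move=> tau_p; pose t := map tau ords5.
have tau_nth k : tau k = nth ord0 t k.
  by rewrite /t -enum_ords5 (nth_map k) ?size_enum_ord // nth_ord_enum.
have t_perm : t \in permutations ords5.
  rewrite mem_permutations /t -enum_ords5 uniq_perm ?enum_uniq //.
    by rewrite (map_inj_uniq perm_inj) enum_uniq.
  move=> k; rewrite mem_enum; apply/mapP; exists (tau^-1 k)%g.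
    by rewrite mem_enum.
  by rewrite permKV.
have: all (fun t =>
    all (fun k : 'I_5 => consecutive (nth ord0 t k) (nth ord0 t (ordS k))) ords5 ==>
    has (fun a => has (fun b => all (fun k : 'I_5 =>
      joint_edge (nth ord0 t k) (nth ord0 t (ordS k)) == a + b * k) ords5)
    [:: 1; -1]) ords5) (permutations ords5).
  by vm_compute.
move=> /allP/(_ _ t_perm)/implyP t_dihedral.
have /t_dihedral/hasP[a _ /hasP[b b_pm /ords5_all pE]] :
    all (fun k : 'I_5 => consecutive (nth ord0 t k) (nth ord0 t (ordS k))) ords5.
  by apply/allP=> k _; rewrite -!tau_nth; exact: (joint_edgeE (tau_p k)).1.
exists a, b; split=> [|k].
  by move: b_pm; rewrite !inE => /orP[]/eqP->; rewrite ?mulrNN mulr1.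
by case: (joint_edgeE (tau_p k)) => _ ->; rewrite !tau_nth; apply/eqP.
Qed.

Lemma dihedral_edges p : dihedral p ->
  exists tau : 'S_5, forall k, perm_eq [:: tau k; tau (ordS k)] [:: p k; ordS (p k)].
Proof.
move=> [a [b [bb pE]]].
(* [b] is [1] or [-1], so the shift is [0] or [1]; [3] is the inverse of [2]. *)
pose t (e : 'I_5) : 'I_5 := a + b * e + 3%:R * (1 - b).
have t_inj : injective t.
  by move=> e f /addIr/addrI/(congr1 ( *%R b)); rewrite !mulrA bb !mul1r.
exists (perm t_inj) => k; rewrite !permE pE /t.
have: all (fun a => all (fun b => all (fun k => (b * b == 1) ==>
    perm_eq [:: a + b * k + 3%:R * (1 - b); a + b * ordS k + 3%:R * (1 - b)]
            [:: a + b * k; ordS (a + b * k)]) ords5) ords5) ords5 by vm_compute.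
move=> /ords5_all/(_ a)/ords5_all/(_ b)/ords5_all/(_ k).
by rewrite bb eqxx.
Qed.

Definition dihedrals : seq (seq nat) := Eval vm_compute in
  [seq [seq nat_of_ord (a + b * k)%R | k <- ords5] | a <- ords5, b <- [:: 1; -1]].

Lemma dihedralsP s :
  s \in dihedrals <-> exists2 p, dihedral p & s = [seq nat_of_ord (p k) | k <- ords5].
Proof.
have -> : dihedrals = [seq [seq nat_of_ord (a + b * k)%R | k <- ords5] |
    a <- ords5, b <- [:: 1; -1]] by vm_compute.
split=> [/allpairsP[[a b] [_ b_pm ->]]|[p [a [b [/eqP bb pE]]] ->]].
  exists (fun k => a + b * k) => //; exists a, b; split=> //.
  by move: b_pm; rewrite /= !inE => /orP[]/eqP->; rewrite ?mulrNN mulr1.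
rewrite (eq_map (g := fun k => nat_of_ord (a + b * k)%R)); last by move=> k; rewrite pE.
apply/allpairsP; exists (a, b); split=> //=; first by rewrite -enum_ords5 mem_enum.
move: bb; have: all (fun b : 'I_5 => (b * b == 1) ==> (b \in [:: 1; -1])) ords5.
  by vm_compute.
by move=> /ords5_all/(_ b)/implyP.
Qed.

Lemma angle_congruentP (R : realType) (ang : corner -> R) i j :
  angle_congruent ang i j <->
  exists2 p, dihedral p & forall k, ang (i, k) = ang (j, p k).
Proof.
split=> [[tau /fin_all_exists[p pP]]|[p /dihedral_edges[tau tauP] pE]].
  by exists p => [|k]; [apply: (edges_dihedral (tau := tau)) => k|]; case: (pP k).
by exists tau => k; exists (p k).
Qed.

(** * The 64 exchanged tilings, indexed by bit masks *)

Fixpoint bitseqs (n : nat) : seq bitseq :=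
  if n is m.+1 then [seq b :: s | b <- [:: true; false], s <- bitseqs m]
  else [:: [::]].

Lemma mem_bitseqs s : s \in bitseqs (size s).
Proof.
by elim: s => // b s IHs; apply: (allpairs_f cons) => //; case: b.
Qed.

Lemma bitseqs_all n (p : pred bitseq) :
  all p (bitseqs n) -> forall s, size s = n -> p s.
Proof. by move=> /allP p_all s sn; apply: p_all; rewrite -sn mem_bitseqs. Qed.

(** [x] pairs a base letter with the index of an exchange edge; an index past the end of [bs] reads
    as [false], which leaves the letter alone. *)
Definition exchanged_letter (bs : bitseq) (x : letter * nat) : letter :=
  if nth false bs x.2 then swap_beta_gamma x.1 else x.1.

(* For each corner, its base letter and the index of the exchange edge it lies
   around ([6] if there is none). *)
Definition model_data : seq (letter * nat) := Eval vm_compute in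
  [seq (base_words c, find (around^~ c) exchange_edges) | c <- corners].

Definition model_datum (c : corner) : letter * nat :=
  nth (Al, 6%N) model_data (c.1 * 5 + c.2).

Definition model_words (bs : bitseq) (c : corner) : letter :=
  exchanged_letter bs (model_datum c).

(* The exchange edges have pairwise disjoint sets of corners around them. *)
Lemma exchanged_words_mask bs c :
  size bs = 6%N -> exchanged_words (mask bs exchange_edges) c = model_words bs c.
Proof.
move=> bs6; apply/eqP; move: c; apply: corner_all; move: bs bs6.
by apply: bitseqs_all; vm_compute.
Qed.

(** At either end of an exchange edge, the two corners around it carry [Be] and [Ga], so an exchange
    only permutes the letters of a vertex. *)
Lemma model_words_vertex bs c : size bs = 6%N ->
  (map (model_words bs) (vertex_corners c) == [:: Al; Al; Al])
  || perm_eq (map (model_words bs) (vertex_corners c)) [:: Be; Ga; De].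
Proof.
move=> bs6.
have -> : map (model_words bs) (vertex_corners c) =
    map (exchanged_letter bs) (map model_datum (vertex_corners c)).
  by rewrite -map_comp.
move: bs bs6; apply: bitseqs_all; move: c; apply: corner_all.
by vm_compute.
Qed.

Definition ref_word : seq letter := [:: De; Al; Be; Ga; Al].

Definition dihedral_images (w : seq letter) : seq (seq letter) :=
  [seq [seq nth Al w k | k <- d] | d <- dihedrals].

Lemma dihedral_imagesP (f : 'I_5 -> letter) w :
  map f ords5 \in dihedral_images w <->
  exists2 p, dihedral p & forall k, f k = nth Al w (p k).
Proof.
split=> [/mapP[d /dihedralsP[p p_dih ->] fE]|[p p_dih fE]].
  exists p => // k; move: fE; rewrite -map_comp => /eq_in_map fE.
  by rewrite fE // -enum_ords5 mem_enum.
apply/mapP; exists [seq nat_of_ord (p k) | k <- ords5]; first by apply/dihedralsP; exists p.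
by rewrite -map_comp; apply: eq_map.
Qed.

(** Each tile has exactly one exchange edge, with its [Be] and [Ga] at the two ends; swapping them
    reflects the word of the tile. *)
Lemma model_words_dihedral bs i : size bs = 6%N ->
  exists2 p, dihedral p & forall k, model_words bs (i, k) = nth Al ref_word (p k).
Proof.
move=> bs6; apply/dihedral_imagesP.
have -> : [seq model_words bs (i, k) | k <- ords5] =
    map (exchanged_letter bs) [seq model_datum (i, k) | k <- ords5].
  by rewrite -map_comp.
have: all (fun n => all (fun bs =>
    map (exchanged_letter bs) [seq model_datum (inZp n, k) | k <- ords5]
      \in dihedral_images ref_word) (bitseqs 6)) (iota 0 12) by vm_compute.
by move=> /ord_all/(_ i)/bitseqs_all/(_ _ bs6); rewrite valZpK.
Qed.

(** * Action of pattern symmetries on corners *)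

Lemma maps_corner_unique sigma c d d' :
  maps_corner sigma c d -> maps_corner sigma c d' -> d = d'.
Proof.
move=> /andP[/eqP d1 dv] /andP[/eqP d1' dv']; apply: corner_eq; first by rewrite d1.
by rewrite (perm_trans dv) // perm_sym.
Qed.

(** Preserving adjacency gives a map from the edges of [i] to those of [sigma i]; preserving
    vertices sends consecutive edges to consecutive edges, and [edges_dihedral] applies. *)
Lemma symmetry_dihedral sigma i : pattern_symmetry sigma ->
  exists2 p, dihedral p & forall k, maps_corner sigma (i, k) (sigma i, p k).
Proof.
move=> [adj_sigma share_sigma].
have /fin_all_exists[t tE] e : exists f, nbr (sigma i) f = sigma (nbr i e).
  have : Defs.adjacent (sigma i) (sigma (nbr i e)).
    by rewrite adj_sigma; apply/existsP; exists e.
  by case/existsP=> f /eqP fE; exists f.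
have t_inj : injective t.
  by move=> e f etf; apply/(@nbr_inj i)/(@perm_inj _ sigma); rewrite -!tE etf.
have /fin_all_exists[p pP] k : exists l, maps_corner sigma (i, k) (sigma i, l).
  have : share_vertex (sigma i) (sigma (nbr i k)) (sigma (nbr i (ordS k))).
    by rewrite share_sigma; apply/existsP; exists (i, k).
  case/existsP=> c cE.
  have : sigma i \in vertex c by rewrite (perm_mem cE) mem_head.
  rewrite vertexE => /mapP[d dc di]; exists d.2.
  rewrite /maps_corner di -surjective_pairing eqxx /=.
  by rewrite (perm_trans _ cE) // same_vertexE.
exists p => //; apply: (@edges_dihedral (perm t_inj)) => k; rewrite !permE.
have /andP[_] := pP k; rewrite /vertex /= perm_cons -!tE => pk.
rewrite perm_sym.
by apply: (@perm_map_inj _ _ _ (@nbr_inj (sigma i))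
  [:: p k; ordS (p k)] [:: t k; t (ordS k)]).
Qed.

(** * From exchanged words to angle congruent tilings *)

Section Converse.
Variables (R : realType) (alpha beta gamma delta : R).
Hypothesis alphaE : alpha = 2 * pi / 3.
Hypothesis sumE : beta + gamma + delta = 2 * pi.

Lemma sum_letter_val s :
  (s == [:: Al; Al; Al]) || perm_eq s [:: Be; Ga; De] ->
  \sum_(w <- s) letter_val alpha beta gamma delta w = 2 * pi.
Proof.
case/orP=> [/eqP->|s_perm]; last first.
  by rewrite (perm_big _ s_perm) !big_cons big_nil /= addr0 addrA.
by rewrite !big_cons big_nil /= alphaE; field.
Qed.

(** The symmetry induces a bijection [phi] of corners that respects sharing a vertex, so vertex sums
    carry over from the model. It is dihedral on each tile, so every tile still reads [ref_word] up
    to a dihedral map. *)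
Lemma symmetry_tiling (bs : bitseq) (sigma : {perm tile}) (ang : corner -> R) :
  size bs = 6%N -> pattern_symmetry sigma ->
  (forall c c', maps_corner sigma c c' ->
     ang c' = letter_val alpha beta gamma delta (model_words bs c)) ->
  angle_congruent_tiling ang /\
  forall i, perm_eq (tile_angles ang i) [:: alpha; alpha; beta; gamma; delta].
Proof.
move=> bs6 sigma_sym angE.
have /fin_all_exists[phi phiP] c : exists d, maps_corner sigma c d.
  by case: c => i k; case: (symmetry_dihedral i sigma_sym) => p _ pE; exists (sigma i, p k).
have phi_vertex c d :
    perm_eq (vertex (phi c)) (vertex (phi d)) = perm_eq (vertex c) (vertex d).
  have /andP[_ /permPl->] := phiP c; have /andP[_ /permPr->] := phiP d.
  by apply/idP/idP => [/perm_map_inj|/perm_map]; apply=> //; apply: perm_inj.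
have phi_inj : injective phi.
  move=> c d cd; apply: corner_eq; last by rewrite -phi_vertex cd.
  apply: (@perm_inj _ sigma); have /andP[/eqP<- _] := phiP c.
  by have /andP[/eqP<- _] := phiP d; rewrite cd.
have [psi _ phiK] := injF_bij phi_inj.
have tileE i : exists2 p, dihedral p & forall k,
    ang (i, k) = letter_val alpha beta gamma delta (nth Al ref_word (p k)).
  (* The angles of [i] are read off the model word of its preimage under [sigma]. *)
  have [p p_dih pE] := symmetry_dihedral ((sigma^-1)%g i) sigma_sym.
  have [q [q_dih _ pK]] := dihedral_inv p_dih.
  have [r r_dih rE] := model_words_dihedral ((sigma^-1)%g i) bs6.
  exists (r \o q) => [|k]; first exact: dihedral_comp.
  by have := angE _ _ (pE (q k)); rewrite permKV pK rE.
split; first split.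
- move=> c0; rewrite -(phiK c0); move: (psi c0) => c.
  rewrite (reindex_inj phi_inj) /=.
  rewrite (eq_bigl _ _ (phi_vertex^~ c)).
  rewrite (eq_bigr (letter_val alpha beta gamma delta \o model_words bs)); last first.
    by move=> d _; apply/angE/phiP.
  rewrite sum_same_vertex -(sum_letter_val (model_words_vertex c bs6)).
  by rewrite !big_cons big_nil addr0 addrA.
- move=> i j; have [p p_dih pE] := tileE i; have [q q_dih qE] := tileE j.
  have [r [r_dih _ qK]] := dihedral_inv q_dih.
  apply/angle_congruentP; exists (r \o p) => [|k]; first exact: dihedral_comp.
  by rewrite pE qE /= qK.
- move=> i; have [p p_dih pE] := tileE i; have [q [_ pK qK]] := dihedral_inv p_dih.
  pose F (k : 'I_5) := letter_val alpha beta gamma delta (nth Al ref_word k).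
  have -> : tile_angles ang i = map F (map p (enum 'I_5)).
    by rewrite -map_comp; apply: eq_map => k; rewrite pE.
  rewrite (perm_trans (y := map F ords5)) //.
    rewrite perm_map // -enum_ords5 uniq_perm ?enum_uniq //.
      by rewrite (map_inj_uniq (can_inj pK)) enum_uniq.
    by move=> k; rewrite mem_enum; apply/mapP; exists (q k); rewrite ?mem_enum ?qK.
  apply: (@perm_map _ _ (letter_val alpha beta gamma delta) ref_word
    [:: Al; Al; Be; Ga; De]).
  by vm_compute.
Qed.

End Converse.

(** * Composition of symmetries and the rotation of order five *)

Lemma pattern_symmetry1 : pattern_symmetry 1%g.
Proof. by split=> *; rewrite !perm1. Qed.

Lemma pattern_symmetryM sigma tau :
  pattern_symmetry sigma -> pattern_symmetry tau -> pattern_symmetry (sigma * tau)%g.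
Proof.
by move=> [sa ss] [ta ts]; split=> *; rewrite !permM ?ta ?ts ?sa ?ss.
Qed.

Lemma maps_cornerM sigma tau c d e :
  maps_corner sigma c d -> maps_corner tau d e -> maps_corner (sigma * tau)%g c e.
Proof.
move=> /andP[/eqP d1 dv] /andP[/eqP e1 ev]; rewrite /maps_corner e1 d1 permM eqxx andTb.
rewrite (eq_map (g := tau \o sigma)); last by move=> i; rewrite permM.
by rewrite map_comp (perm_trans ev) // perm_map.
Qed.

(* The rotation by one fifth of a turn about the centers of P_1 and P_12. *)
Definition rot_tile (i : tile) : tile :=
  inZp (nth 0 [:: 0; 2; 3; 4; 5; 1; 7; 8; 9; 10; 6; 11] i)%N.

Definition tiles : seq tile := [seq inZp i | i <- iota 0 12].

Lemma enum_tiles : enum 'I_12 = tiles.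
Proof. by apply: (inj_map val_inj); rewrite val_enum_ord. Qed.

Lemma tiles_all (p : pred tile) : all p tiles -> forall i, p i.
Proof.
by rewrite all_map => /ord_all p_all i; have /= := p_all i; rewrite valZpK.
Qed.

Lemma rot_tile_inj : injective rot_tile.
Proof.
move=> i j /eqP ij; apply/eqP; move: ij.
have: all (fun i => all (fun j => (rot_tile i == rot_tile j) ==> (i == j)) tiles) tiles.
  by vm_compute.
by move=> /tiles_all/(_ i)/tiles_all/(_ j)/implyP.
Qed.

Definition pattern_rot : {perm tile} := perm rot_tile_inj.

(** A rotation keeps the counterclockwise order of edges, so the image corner starts at the edge
    toward the image of the tile across edge [c.2]. *)
Definition rot_corner (c : corner) : corner :=
  let j := rot_tile c.1 in
  (j, inZp (index (rot_tile (nbr c.1 c.2)).+1 (nth [::] neighbor_table j))).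

Lemma maps_rot_corner c : maps_corner pattern_rot c (rot_corner c).
Proof.
rewrite /maps_corner permE eqxx andTb (eq_map (permE rot_tile_inj)).
by move: c; apply: corner_all; vm_compute.
Qed.

Lemma rot_corner_inj : injective rot_corner.
Proof.
move=> c d /eqP cd; apply/eqP; move: cd; apply/implyP.
by move: c d; apply: corner_all2; vm_compute.
Qed.

Lemma adjacentE i j : Defs.adjacent i j = has (fun k => nbr i k == j) ords5.
Proof.
apply/existsP/hasP => [[k ij]|[k _ ij]]; exists k => //.
by rewrite -enum_ords5 mem_enum.
Qed.

Lemma rot_symmetry : pattern_symmetry pattern_rot.
Proof.
split=> [i j|i j k].
  rewrite !permE !adjacentE; apply/eqP.
  have: all (fun i => all (fun j => has (fun k => nbr (rot_tile i) k == rot_tile j) ords5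
    == has (fun k => nbr i k == j) ords5) tiles) tiles by vm_compute.
  by move=> /tiles_all/(_ i)/tiles_all/(_ j).
have rot_vertex c :
    perm_eq (vertex (rot_corner c)) [:: pattern_rot i; pattern_rot j; pattern_rot k] =
    perm_eq (vertex c) [:: i; j; k].
  have /andP[_ /permPl->] := maps_rot_corner c.
  apply/idP/idP => [|/(perm_map pattern_rot) //].
  exact: (@perm_map_inj _ _ _ (@perm_inj _ pattern_rot) (vertex c) [:: i; j; k]).
have [inv_rot _ rotK] := injF_bij rot_corner_inj.
apply/existsP/existsP => [[c cE]|[c cE]].
  by exists (inv_rot c); rewrite -rot_vertex rotK.
by exists (rot_corner c); rewrite rot_vertex.
Qed.

Lemma rotX_symmetry r : pattern_symmetry (pattern_rot ^+ r)%g.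
Proof.
elim: r => [|r IHr]; first exact: pattern_symmetry1.
by rewrite expgSr; apply: pattern_symmetryM rot_symmetry.
Qed.

Lemma maps_rotX_corner r c : maps_corner (pattern_rot ^+ r)%g c (iter r rot_corner c).
Proof.
elim: r => [|r IHr]; last by rewrite expgSr; apply: maps_cornerM IHr (maps_rot_corner _).
by rewrite /maps_corner perm1 eqxx (eq_map (@perm1 _)) map_id perm_refl.
Qed.

(** * The constraint search and the classification of words *)

Definition compatible (v w : letter) : bool :=
  match v, w with
  | Al, Al => true
  | Al, _ | _, Al | Be, Be | Ga, Ga | De, De => false
  | _, _ => true
  end.

Definition constraint := (nat * (nat * nat))%type.

Definition lookup (ws : seq (seq letter)) (x : nat * nat) : letter :=
  nth Al (nth [::] ws x.1) x.2.

(* The lists in [css] constrain the successive words to be chosen: [(k, x)]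
   asks the [k]-th letter of the new word to be compatible with the letter at
   [x] in the words already chosen. *)
Fixpoint search (dom : seq (seq letter)) (css : seq (seq constraint))
    (ws : seq (seq letter)) (leaf : pred (seq (seq letter))) : bool :=
  if css is cs :: css' then
    all (fun w =>
      if all (fun x => compatible (nth Al w x.1) (lookup ws x.2)) cs
      then search dom css' (rcons ws w) leaf else true) dom
  else leaf ws.

(** An assignment that meets all constraints is never pruned, so the search reaches it as a leaf.
    The bound on [x.2.1] places the letter referred to among the words already chosen, where looking
    it up in the partial or the full list agrees. *)
Lemma searchP dom css ws leaf rest :
    search dom css ws leaf -> size rest = size css -> {subset rest <= dom} ->
    (forall n x, x \in nth [::] css n -> (x.2.1 < size ws + n)%N /\
       compatible (nth Al (nth [::] rest n) x.1) (lookup (ws ++ rest) x.2)) ->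
  leaf (ws ++ rest).
Proof.
elim: css ws rest => [|cs css IHcss] ws [|w rest] //=; first by rewrite cats0.
move=> /allP dom_ok [sz] sub_dom ok.
have := dom_ok w (sub_dom w (mem_head _ _)); case: ifP => [_ rec_ok|/negP[]].
  rewrite -cat_rcons; apply: IHcss => // [v v_rest|n x x_cs].
    by apply: sub_dom; rewrite inE v_rest orbT.
  by rewrite size_rcons cat_rcons addSnnS; apply: (ok n.+1).
apply/allP=> x x_cs; have [] := ok 0%N x x_cs; rewrite addn0 => lt_x.
by rewrite /lookup nth_cat lt_x.
Qed.

Definition nat_corner (c : corner) : nat * nat := (nat_of_ord c.1, nat_of_ord c.2).

(** Each pair of corners at a vertex is recorded at the later of its two tiles, so that a branch is
    pruned as soon as both words are known. *)
Definition constraints : seq (seq constraint) := Eval vm_compute in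
  [seq flatten [seq [seq (nat_of_ord k, nat_corner d) |
                      d : corner <- behead (vertex_corners (inZp n, k)) & (d.1 < n)%N] | k <- ords5]
  | n <- iota 0 12].

Lemma constraintsP n x : x \in nth [::] constraints n ->
  [/\ (n < 12)%N, (x.2.1 < n)%N &
      exists2 k : 'I_5, x.1 = k &
      exists2 d, x.2 = nat_corner d & d \in behead (vertex_corners (inZp n, k))].
Proof.
have [n12 xn|n12] := ltnP n 12; last by rewrite nth_default.
have: all (fun n => all (fun x : constraint => [&& (x.2.1 < n)%N, (x.1 < 5)%N,
    nat_corner (corner_of x.2.1 x.2.2) == x.2 &
    corner_of x.2.1 x.2.2 \in behead (vertex_corners (inZp n, inZp x.1))])
    (nth [::] constraints n)) (iota 0 12) by vm_compute.
move=> /allP/(_ n); rewrite mem_iota => /(_ n12)/allP/(_ x xn)/and4P[lt_x x5 /eqP xE xv].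
split=> //; exists (inZp x.1); first by rewrite /= modn_small.
by exists (corner_of x.2.1 x.2.2).
Qed.

(** The 60 arrangements fall into six dihedral orbits of size ten. In the first three the two [Al]
    are adjacent and the orbit is fixed by the letter opposite them; in the last three it is fixed
    by the letter between them. *)
Definition representatives : seq (seq letter) :=
  [:: [:: Al; Al; Be; Ga; De]; [:: Al; Al; Be; De; Ga]; [:: Al; Al; Ga; Be; De];
      [:: Al; Be; Al; Ga; De]; [:: Al; Ga; Al; Be; De]; [:: Al; De; Al; Be; Ga]].

Lemma representativesP w : perm_eq w [:: Al; Al; Be; Ga; De] ->
  exists2 r, r \in representatives &
    {subset dihedral_images w <= dihedral_images r}.
Proof.
rewrite -mem_permutations => w_perm.
have: all (fun w => has (fun r => all (mem (dihedral_images r)) (dihedral_images w))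
  representatives) (permutations [:: Al; Al; Be; Ga; De]) by vm_compute.
by move=> /allP/(_ _ w_perm)/hasP[r r_rep /allP]; exists r.
Qed.

Definition rotated_corners : seq (seq (nat * nat)) := Eval vm_compute in
  [seq [seq nat_corner (iter r rot_corner c) | c <- corners] | r <- iota 0 5].

(* For each exchange edge, the index in [corners] of a corner around it. *)
Definition edge_corners : seq nat := Eval vm_compute in
  [seq find (fun x : letter * nat => x.2 == n) model_data | n <- iota 0 6].

Definition rename (names : seq letter) : letter -> letter :=
  letter_val Al (nth Al names 0) (nth Al names 1) (nth Al names 2).

(** The exchanges need no search: one corner around each exchange edge tells whether its letter
    differs from the renamed base letter. The final equality then tests all sixty corners. *)
Definition is_model (ws : seq (seq letter)) : bool :=
  has (fun xs => has (fun names =>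
      let read := [seq lookup ws x | x <- xs] in
      let bs := [seq nth Al read n != rename names (nth (Al, 0%N) model_data n).1
                | n <- edge_corners] in
      read == [seq rename names (exchanged_letter bs x) | x <- model_data])
    (permutations [:: Be; Ga; De])) rotated_corners.

Lemma search_representatives :
  all (fun r => search (dihedral_images r) constraints [::] is_model) representatives.
Proof. by vm_compute. Qed.

Definition words_of (W : corner -> letter) : seq (seq letter) :=
  [seq [seq W (i, k) | k <- ords5] | i <- tiles].

Lemma lookup_words_of W c : lookup (words_of W) (nat_corner c) = W c.
Proof.
case: c => i k; rewrite /lookup /words_of -enum_tiles -enum_ords5 /=.
rewrite (nth_map i) ?size_enum_ord // nth_ord_enum.
by rewrite (nth_map k) ?size_enum_ord // nth_ord_enum.
Qed.

Lemma is_modelP W : is_model (words_of W) ->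
  exists r names bs, [/\ size bs = 6%N, perm_eq names [:: Be; Ga; De] &
    forall c, W (iter r rot_corner c) = rename names (model_words bs c)].
Proof.
have rotE : rotated_corners =
    [seq [seq nat_corner (iter r rot_corner c) | c <- corners] | r <- iota 0 5].
  by vm_compute.
have dataE : model_data = map model_datum corners by vm_compute.
rewrite /is_model rotE => /hasP[_ /mapP[r _ ->] /hasP[names]].
rewrite mem_permutations => names_perm /eqP; set bs := [seq _ | _ <- edge_corners].
move=> readE; exists r, names, bs; split=> [//|//|c].
move: readE; rewrite dataE -!map_comp => /eq_in_map/(_ c (mem_corners c)) /=.
by rewrite lookup_words_of.
Qed.

(** The word of the first tile selects the representative; congruence confines every other word to
    the ten dihedral images of it, which form the search domain. *)
Lemma classification W :
  (forall c, compatible (W c) (W (next_corner c)) &&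
             compatible (W c) (W (next_corner (next_corner c)))) ->
  (forall i, perm_eq [seq W (i, k) | k <- ords5] [:: Al; Al; Be; Ga; De]) ->
  (forall i j, exists2 p, dihedral p & forall k, W (i, k) = W (j, p k)) ->
  exists r names bs, [/\ size bs = 6%N, perm_eq names [:: Be; Ga; De] &
    forall c, W (iter r rot_corner c) = rename names (model_words bs c)].
Proof.
move=> W_compat W_perm W_dihedral; apply: is_modelP.
have [r r_rep sub_r] := representativesP (W_perm ord0).
have search_r := allP search_representatives r r_rep.
apply: (searchP (rest := words_of W) search_r).
- by rewrite size_map.
- move=> _ /mapP[i _ ->]; apply: sub_r; apply/dihedral_imagesP.
  have [p p_dih pE] := W_dihedral i ord0; exists p => // k.
  by rewrite pE -enum_ords5 (nth_map k) ?size_enum_ord // nth_ord_enum.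
move=> n x /constraintsP[n12 lt_x [k xk [d xd dk]]]; split=> //.
rewrite xd cat0s lookup_words_of xk.
have -> : nth [::] (words_of W) n = [seq W (inZp n, k) | k <- ords5].
  rewrite /words_of (nth_map ord0) /tiles ?size_map ?size_iota //.
  by rewrite (nth_map 0%N) ?size_iota // nth_iota // add0n.
rewrite -enum_ords5 (nth_map k) ?size_enum_ord // nth_ord_enum.
have /andP[W1 W2] := W_compat (inZp n, k).
by move: dk; rewrite !inE => /orP[]/eqP->.
Qed.

(** * From angles to letters *)

Section Letters.
Variables (R : realType) (alpha beta gamma delta : R).
Hypothesis alphaE : alpha = 2 * pi / 3.
Hypothesis distinct : uniq [:: alpha; beta; gamma; delta].

Local Notation lval := (letter_val alpha beta gamma delta).

Lemma letter_val_inj : injective lval.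
Proof.
move: distinct; rewrite /= !inE !negb_or -!andbA => /and4P[/eqP ab /eqP ag /eqP ad].
move=> /and4P[/eqP bg /eqP bd /eqP gd _].
by case; case=> //= e; first [case: (ab e) | case: (ag e) | case: (ad e)
  | case: (bg e) | case: (bd e) | case: (gd e) | case: (ab (esym e)) | case: (ag (esym e))
  | case: (ad (esym e)) | case: (bg (esym e)) | case: (bd (esym e)) | case: (gd (esym e))].
Qed.

(** Inverse of [letter_val] on the angles of a tile; any other real falls through to [De]. *)
Definition letter_of (x : R) : letter :=
  if x == alpha then Al else if x == beta then Be else if x == gamma then Ga else De.

Lemma letter_ofK x : x \in [:: alpha; alpha; beta; gamma; delta] -> lval (letter_of x) = x.
Proof.
rewrite !inE /letter_of; do 3 (case: eqP => //=).
by move=> _ _ _ /eqP.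
Qed.

(** Subtracting [3 * alpha] or [beta + gamma + delta] from the vertex sum, an incompatible pair [u],
    [v] forces two of the four angles to coincide, whatever [w] is. *)
Lemma compatible_of_sum u v w : beta + gamma + delta = 2 * pi ->
  lval u + lval v + lval w = 2 * pi -> compatible u v.
Proof.
move=> sumE; move: distinct; rewrite /= !inE !negb_or -!andbA.
move=> /and4P[/eqP ab /eqP ag /eqP ad] /and4P[/eqP bg /eqP bd /eqP gd _].
have alpha3 : 3 * alpha = 2 * pi by rewrite alphaE; field.
move: u v w => [] [] [] //= e; exfalso;
first [apply: ab; lra | apply: ag; lra | apply: ad; lra
      | apply: bg; lra | apply: bd; lra | apply: gd; lra].
Qed.

(** Double counting: adding the vertex sums over all 60 corners counts every angle three times,
    while the twelve tiles give the total of all angles directly. *)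
Lemma tiling_sum (ang : corner -> R) :
  (forall c, ang c + ang (next_corner c) + ang (next_corner (next_corner c)) = 2 * pi) ->
  (forall i, perm_eq (tile_angles ang i) [:: alpha; alpha; beta; gamma; delta]) ->
  beta + gamma + delta = 2 * pi.
Proof.
move=> vertex_sum tile_perm.
have next_inj : injective next_corner.
  by move=> c d cd; rewrite -(next_corner3 c) cd next_corner3.
have sum_next (F : corner -> R) : \sum_c F (next_corner c) = \sum_c F c.
  by rewrite [RHS](reindex_inj next_inj).
have sum_tiles : \sum_c ang c = 12 * (2 * alpha + beta + gamma + delta).
  have -> : \sum_c ang c = \sum_i \sum_k ang (i, k).
    by rewrite pair_bigA; apply: eq_bigr => -[].
  rewrite (eq_bigr (fun _ => 2 * alpha + beta + gamma + delta)) => [|i _].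
    by rewrite sumr_const card_ord [RHS]mulr_natl.
  have -> : \sum_k ang (i, k) = \sum_(x <- tile_angles ang i) x.
    by rewrite /tile_angles big_image.
  by rewrite (perm_big _ (tile_perm i)) !big_cons big_nil /=; ring.
have : \sum_c (ang c + ang (next_corner c) + ang (next_corner (next_corner c))) =
    60 * (2 * pi).
  rewrite (eq_bigr _ (fun c _ => vertex_sum c)) sumr_const card_prod !card_ord.
  by rewrite [RHS]mulr_natl.
rewrite !big_split /= (sum_next (fun c => ang (next_corner c))) sum_next.
have alpha3 : 3 * alpha = 2 * pi by rewrite alphaE; field.
by rewrite sum_tiles; lra.
Qed.

End Letters.

Theorem proposition19 (R : realType) (alpha beta gamma delta : R)
    (alphaE : alpha = 2 * pi / 3)
    (distinct : uniq [:: alpha; beta; gamma; delta])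
    (ang : corner -> R) :
  (angle_congruent_tiling ang /\
   forall i : tile,
     perm_eq (tile_angles ang i) [:: alpha; alpha; beta; gamma; delta])
  <->
  (beta + gamma + delta = 2 * pi /\
   exists (s : seq edge) (sigma : {perm tile}) (beta' gamma' delta' : R),
     [/\ subseq s exchange_edges,
         pattern_symmetry sigma,
         perm_eq [:: beta'; gamma'; delta'] [:: beta; gamma; delta] &
         forall c c' : corner, maps_corner sigma c c' ->
           ang c' = letter_val alpha beta' gamma' delta' (exchanged_words s c)]).
Proof.
split=> [[[vertex_sum congruent] tile_perm]|]; last first.
  move=> [sumE [s [sigma [b [g [d [s_sub sigma_sym bgd angE]]]]]]].
  (* The chosen exchange edges become a mask of length six, the form in which the model is
     computed. *)
  have /subseqP[bs bs6 sE] := s_sub.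
  have bgd_sum : b + g + d = 2 * pi.
    suff: \sum_(x <- [:: b; g; d]) x = 2 * pi by rewrite !big_cons big_nil addr0 addrA.
    by rewrite (perm_big _ bgd) !big_cons big_nil /= addr0 addrA.
  have [|tiling tiles_perm] :=
      @symmetry_tiling _ alpha b g d alphaE bgd_sum bs sigma ang bs6 sigma_sym.
    by move=> c c' cc'; rewrite (angE c c' cc') sE exchanged_words_mask.
  split=> // i; apply: (perm_trans (tiles_perm i)).
  by rewrite !perm_cons.
have {}vertex_sum c :
    ang c + ang (next_corner c) + ang (next_corner (next_corner c)) = 2 * pi.
  by rewrite -(vertex_sum c) sum_same_vertex.
have sumE := tiling_sum alphaE vertex_sum tile_perm.
split=> //.
pose lval := letter_val alpha beta gamma delta.
pose W c := letter_of alpha beta gamma (ang c).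
have angW c : lval (W c) = ang c.
  apply: letter_ofK; case: c => i k; rewrite -(perm_mem (tile_perm i)).
  by apply/mapP; exists k; rewrite ?mem_enum.
have lval_inj : injective lval := letter_val_inj distinct.
have [c|i|i j|r [names [bs [bs6 names_perm WE]]]] := @classification W.
- have compatW := compatible_of_sum alphaE distinct sumE; apply/andP; split.
    by apply: (compatW _ _ (W (next_corner (next_corner c)))); rewrite -/lval !angW.
  apply: (compatW _ _ (W (next_corner c))); rewrite -/lval !angW.
  by rewrite -(vertex_sum c) addrAC.
- apply: (perm_map_inj lval_inj); rewrite -map_comp.
  rewrite (perm_trans _ (tile_perm i)) // /tile_angles -enum_ords5.
  by rewrite (eq_map (g := fun k => ang (i, k))) // => k; apply: angW.
- have /angle_congruentP[p p_dih pE] := congruent i j; exists p => // k.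
  by apply: lval_inj; rewrite !angW.
have [b [g [d namesE]]] : exists b g d, names = [:: b; g; d].
  have := perm_size names_perm; move: names {names_perm WE} => [|b [|g [|d []]]] // _.
  by exists b, g, d.
(* The renaming of letters found by the search becomes the permutation of [beta], [gamma], [delta],
   and its number of turns becomes the symmetry. *)
exists (mask bs exchange_edges), (pattern_rot ^+ r)%g, (lval b), (lval g), (lval d).
split.
- exact: mask_subseq.
- exact: rotX_symmetry.
- by have := perm_map lval names_perm; rewrite namesE.
(* A symmetry moves a corner to only one corner, so [c'] is [c] turned [r] times. *)
move=> c c' cc'; rewrite (maps_corner_unique cc' (maps_rotX_corner r c)).
rewrite -angW WE exchanged_words_mask // namesE /rename /=.
by case: (model_words bs c).
Qed.
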